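(* Let $R$ be an integrally closed domain with field of fractions $K$. Let $n\geq 2$ and let $A\in \mathrm{M}_n(R)$ be a non-scalar matrix. Then, for any $\gamma_1,\dots,\gamma_n\in R$ such that $\gamma_1+\dots+\gamma_n=\mathrm{Tr}(A)$, there exists a matrix $B\in \mathrm{M}_n(R)$ with diagonal $(\gamma_1,\dots,\gamma_n)$ such that $A$ is $K$-similar to $B$.
   Context: $\mathrm{M}_n(R)$ denotes the ring of $n\times n$ matrices over $R$. An integrally closed domain is an integral domain that is integrally closed in its field of fractions. For a commutative ring $S$, two matrices $A,B\in \mathrm{M}_n(S)$ are called $S$-similar if there exists $g\in \mathrm{GL}_n(S)$ such that $gAg^{-1}=B$; matrices over $R$ are regarded as matrices over $K$ when speaking of $K$-similarity. A matrix is scalar if it equals $\lambda I_n$ for some $\lambda$ in the ring. *)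

(* Defs.v *)
From mathcomp Require Import all_boot all_order all_algebra.

Set Implicit Arguments.
Unset Strict Implicit.
Unset Printing Implicit Defensive.

Import GRing.Theory.
Local Open Scope ring_scope.

Definition integrally_closed (R : idomainType) : Prop :=
  forall z : {fraction R},
    integralOver (@tofrac R) z -> exists r : R, z = tofrac r.

(* Main.v *)
(** Monic factors over K of a monic polynomial over R have coefficients in R,
    since these coefficients are polynomials in roots that are integral over R.
    For a row vector v, the Krylov vectors v, vA, vA^2, ... span an A-stable
    subspace on which A acts by a companion matrix; completing them to a basis
    makes A block triangular over K, with a companion block over R and a
    quotient block whose characteristic polynomial is again over R.  By
    induction the quotient block becomes integral, and scaling the
    complementary basis vectors by a common denominator makes the
    off-diagonal block integral.  When A is not scalar, v can be chosen not to
    be an eigenvector: the companion block then has size at least 2 and the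
    entry (0, 1) of the integral matrix is 1.  This unit entry is enough to
    prescribe the diagonal by conjugations over R. *)
Require Import Defs.
From mathcomp Require Import all_boot all_order all_algebra ring.

Set Implicit Arguments.
Unset Strict Implicit.
Unset Printing Implicit Defensive.

Import GRing.Theory.
Local Open Scope ring_scope.

(** * Integrality of the coefficients of monic factors *)

(** [S] is the quotient of [{poly K}] by [g] and [x] is the class of the variable; constants embed
    because [g] has positive degree. *)
Lemma monic_root_extension (K : comNzRingType) (g : {poly K}) :
    g \is monic -> (1 < size g)%N ->
  exists (S : comNzRingType) (phi : {rmorphism K -> S}) (x : S),
    injective phi /\ root (map_poly phi g) x.
Proof.
move=> g_monic g_gt1.
exists {poly %/ g}, (in_qpoly g \o polyC : {rmorphism K -> {poly %/ g}}).
exists (in_qpoly g 'X); split=> [a b /(congr1 val) /=|].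
  rewrite !Pdiv.Ring.rmodp_small; first exact: polyC_inj.
  - by rewrite (leq_ltn_trans (size_polyC_leq1 _)) ?size_mk_monic_gt1.
  - by rewrite (leq_ltn_trans (size_polyC_leq1 _)) ?size_mk_monic_gt1.
rewrite rootE map_poly_comp horner_map /= -/(comp_poly _ _) comp_polyXr.
(* The quotient reduces modulo [mk_monic g], which is [g] itself only for monic [g] of size above
   1. *)
by apply/eqP/val_inj; rewrite /= /mk_monic g_gt1 g_monic Pdiv.RingMonic.rmodpp.
Qed.

(** Induction on the size of [g]: once a root [x] is adjoined, the factor ['X - x%:P] moves from [g]
    to [h]. The extensions may have zero divisors, so the argument rests on monicity. *)
Lemma integral_monic_factor (R K : comNzRingType) (RtoK : {rmorphism R -> K})
    (g h : {poly K}) :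
    g \is monic -> h \is monic ->
    (forall i, integralOver RtoK (g * h)`_i) ->
  forall i, integralOver RtoK g`_i.
Proof.
have [m] := ubnP (size g); elim: m K RtoK g h => // m IHm K RtoK g h.
rewrite ltnS => g_le g_monic h_monic int_gh.
have [g_le1|g_gt1] := leqP (size g) 1.
  have -> : g = 1.
    rewrite (size1_polyC g_le1); move/monicP: g_monic.
    by rewrite {1}(size1_polyC g_le1) lead_coefC => ->.
  by move=> i; rewrite coef1; exact: integral_nat.
have [S [phi [x [phi_inj gx0]]]] := monic_root_extension g_monic g_gt1.
pose RtoS : {rmorphism R -> S} := phi \o RtoK.
have int_phi (p : {poly K}) : (forall i, integralOver RtoK p`_i) ->
    forall i, integralOver RtoS (map_poly phi p)`_i.
  by move=> intp i; rewrite coef_map; exact: integral_rmorph.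
have [g1 Dg] := factor_theorem _ _ gx0.
have g1_monic : g1 \is monic.
  by rewrite -(monicMr _ (monicXsubC x)) -Dg monic_map.
have int_x : integralOver RtoS x.
  apply: (@integral_root_monic _ _ _ _ (map_poly phi (g * h))).
  - by rewrite monic_map // monicMl.
  - by rewrite rootE rmorphM hornerM (rootP gx0) mul0r.
  - by apply/integral_poly/int_phi.
have int_g1 : forall i, integralOver RtoS g1`_i.
  apply: (IHm _ _ _ (('X - x%:P) * map_poly phi h)) => //.
    have -> : size g1 = (size g).-1.
      have lg : phi (lead_coef g) != 0.
        by rewrite (monicP g_monic) rmorph1 oner_neq0.
      rewrite -(size_map_poly_id0 lg) Dg size_Mmonic ?monicXsubC ?monic_neq0 //.
      by rewrite size_XsubC addn2.
    by rewrite (leq_trans _ g_le) // prednK // ltnW.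
  - by rewrite monicMl ?monicXsubC ?monic_map.
  - by rewrite mulrA -Dg -rmorphM; exact: int_phi.
have int_g i : integralOver RtoS (phi g`_i).
  rewrite -coef_map Dg mulrBr coefB coefMX coefMC; apply: integral_sub.
    by case: eqP => // _; exact: integral0.
  exact: integral_mul.
(* A monic polynomial that kills the image of a coefficient kills the coefficient, by injectivity of
   [phi]. *)
move=> i; have [q q_monic] := int_g i.
rewrite map_poly_comp rootE horner_map -(rmorph0 phi).
by move=> /eqP/phi_inj/eqP qg0; exists q.
Qed.

Lemma integrally_closed_monic_factor (R : idomainType) (f : {poly R})
    (g h : {poly {fraction R}}) :
    integrally_closed R -> g \is monic -> h \is monic ->
    map_poly (@tofrac R) f = g * h ->
  exists g' : {poly R}, g = map_poly (@tofrac R) g'.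
Proof.
move=> hR g_monic h_monic Df.
have int_g i : exists r : R, g`_i = tofrac r.
  apply/hR/(integral_monic_factor g_monic h_monic) => j.
  by rewrite -Df coef_map; exact: integral_id.
have /fin_all_exists [r Dr] (i : 'I_(size g)) := int_g i.
exists (\poly_(i < size g) (if insub i is Some k then r k else 0)).
apply/polyP=> i; rewrite coef_map coef_poly.
case: ltnP => [lt_ig|le_gi]; last by rewrite nth_default // rmorph0.
by rewrite insubT; exact: (Dr (Ordinal lt_ig)).
Qed.

(** * Characteristic polynomials, denominators and stable subspaces *)

Lemma char_poly_similar (F : fieldType) n (P A B : 'M[F]_n) :
  P \in unitmx -> P *m A = B *m P -> char_poly A = char_poly B.
Proof.
move=> P_unit PA.
have detP_neq0 : (\det P)%:P != 0 by rewrite polyC_eq0 -unitfE -unitmxE.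
apply: (mulfI detP_neq0); rewrite [RHS]mulrC -det_map_mx -!det_mulmx.
by rewrite mulmxBr mulmxBl -!map_mxM PA scalar_mxC.
Qed.

Lemma char_poly_lblock (R : comNzRingType) m n
    (A : 'M[R]_m) (X : 'M[R]_(n, m)) (D : 'M[R]_n) :
  char_poly (block_mx A 0 X D) = char_poly A * char_poly D.
Proof.
rewrite /char_poly -(det_lblock _ (- map_mx polyC X)); congr (\det _).
rewrite /char_poly_mx map_block_mx /= map_mx0.
by rewrite scalar_mx_block opp_block_mx add_block_mx oppr0 !add0r.
Qed.

Lemma fraction_denominator (R : idomainType) (z : {fraction R}) :
  exists a d : R, d != 0 /\ tofrac d * z = tofrac a.
Proof.
elim/quotW: z => x; exists x.1, x.2; split; first exact: denom_ratioP.
unlock tofrac; rewrite -[LHS]FracField.pi_mul; apply/eqmodP.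
by rewrite /= FracField.equivfE /FracField.mulf /= !numden_Ratio
  ?(oner_neq0, mul1r, mulr1, denom_ratioP) // mulrC.
Qed.

Lemma mx_common_denominator (R : idomainType) m n
    (X : 'M[{fraction R}]_(m, n)) :
  exists (Y : 'M[R]_(m, n)) (d : R),
    d != 0 /\ tofrac d *: X = map_mx (@tofrac R) Y.
Proof.
have /fin_all_exists [a] (ij : 'I_m * 'I_n) :=
  fraction_denominator (X ij.1 ij.2).
move=> /fin_all_exists [d /all_and2 [d_neq0 Dd]].
exists (\matrix_(i, j) (a (i, j) * \prod_(k | k != (i, j)) d k)), (\prod_k d k).
split; first by apply/prodf_neq0 => k _.
apply/matrixP=> i j; rewrite !mxE (bigD1 (i, j)) //= !rmorphM /=.
by rewrite mulrAC (Dd (i, j)).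
Qed.

(** [W] is a basis of a complement of the row space of [U]; [X] and [D] are the coordinates of
    [W *m A] in the completed basis. *)
Lemma row_free_stable_block (F : fieldType) d n (U : 'M[F]_(d, n))
    (C : 'M[F]_d) (A : 'M[F]_n) :
    row_free U -> U *m A = C *m U ->
  exists (m : nat) (W : 'M[F]_(m, n)) (X : 'M[F]_(m, d)) (D : 'M[F]_m),
    [/\ n = (d + m)%N, row_free (col_mx U W)
      & W *m A = X *m U + D *m W].
Proof.
move=> U_free UA; pose W := row_base U^C%MS.
have DUW : (col_mx U W :=: U + U^C)%MS.
  apply: eqmx_trans (eqmx_sym (addsmxE _ _)) _.
  exact: adds_eqmx (eqmx_refl _) (eq_row_base _).
have UW_full : row_full (col_mx U W).
  by rewrite -sub1mx DUW sub1mx addsmx_compl_full.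
have Dn : n = (d + \rank (U^C)%MS)%N.
  by rewrite mxrank_compl (eqP U_free) subnKC // -{1}(eqP U_free) rank_leq_col.
pose XD := W *m A *m pinvmx (col_mx U W).
have WA : XD *m col_mx U W = W *m A by rewrite mulmxKpV // submx_full.
exists (\rank (U^C)%MS), W, (lsubmx XD), (rsubmx XD); split=> //.
  by apply/eqP; rewrite (eqP UW_full).
by rewrite -WA -{1}[XD]hsubmxK mul_row_col.
Qed.

(** * Krylov vectors and companion blocks *)

Definition krylov_mx (F : fieldType) n (A : 'M[F]_n) (v : 'rV[F]_n) d :
  'M[F]_(d, n) := \matrix_(i < d) (v *m A ^+ i).

(** The first linear dependency among the Krylov vectors, normalized, gives the minimal polynomial
    of [v] relative to [A]. *)
Lemma krylov_minpoly (F : fieldType) n (A : 'M[F]_n) (v : 'rV[F]_n) :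
  exists p : {poly F},
    [/\ p \is monic, row_free (krylov_mx A v (size p).-1)
      & \sum_(i < size p) p`_i *: (v *m A ^+ i) = 0].
Proof.
have ex_dep : exists k, ~~ row_free (krylov_mx A v k).
  exists n.+1; rewrite /row_free neq_ltn ltnS.
  by rewrite (leq_trans (rank_leq_col _)).
case: (ex_minnP ex_dep) => k k_dep k_min.
move: k_dep; rewrite -kermx_eq0 => /rowV0Pn [w /sub_kermxP wK0 w_neq0].
pose q := rVpoly w.
have q_neq0 : q != 0.
  by apply: contraNneq w_neq0 => q0; rewrite -(rVpolyK w) -/q q0 linear0.
have size_q : (size q <= k)%N by exact: size_poly.
have lq_neq0 : (lead_coef q)^-1 != 0 by rewrite invr_eq0 lead_coef_eq0.
exists ((lead_coef q)^-1 *: q); split.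
- by rewrite monicE lead_coefZ mulVf // lead_coef_eq0.
(* A dependency among fewer vectors would give [k <= (size q).-1], against [size q <= k]. *)
- apply/negPn; apply: contraT => /negPn/k_min; rewrite size_scale //.
  by rewrite leqNgt (leq_trans _ size_q) // prednK // size_poly_gt0.
- rewrite size_scale //.
  rewrite (big_ord_widen _ (fun i => ((_ *: q)`_i *: (v *m A ^+ i))) size_q).
  transitivity ((lead_coef q)^-1 *: (w *m krylov_mx A v k)); last first.
    by rewrite wK0 scaler0.
  rewrite big_mkcond mulmx_sum_row scaler_sumr; apply: eq_bigr => i _.
  rewrite rowK coefZ -scalerA coef_rVpoly_ord.
  case: ltnP => // le_qi.
  by rewrite -(coef_rVpoly_ord w) -/q nth_default // scale0r scaler0.
Qed.

(** [A] shifts each Krylov vector to the next one; the relation given by [p] rewrites the image of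
    the last. *)
Lemma krylov_companion (F : fieldType) n (A : 'M[F]_n) (v : 'rV[F]_n)
    (p : {poly F}) :
    p \is monic -> \sum_(i < size p) p`_i *: (v *m A ^+ i) = 0 ->
  krylov_mx A v (size p).-1 *m A = companionmx p *m krylov_mx A v (size p).-1.
Proof.
move=> p_monic pv0; apply/row_matrixP=> i.
rewrite !row_mul rowK -mulmxA [RHS]mulmx_sum_row.
have -> : A ^+ i *m A = A ^+ i.+1 by rewrite exprSr.
have size_p : (0 < size p)%N by rewrite size_poly_gt0 monic_neq0.
have [i_last|i_small] := eqVneq (i : nat) (size p).-2.
  move: pv0; have -> : \sum_(j < size p) p`_j *: (v *m A ^+ j) =
      \sum_(j < (size p).-1) p`_j *: (v *m A ^+ j)
        + p`_(size p).-1 *: (v *m A ^+ (size p).-1).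
    by case: (size p) size_p => // s _; rewrite big_ord_recr.
  have -> : p`_(size p).-1 = 1 by exact: monicP p_monic.
  have -> : i.+1 = (size p).-1.
    by rewrite i_last prednK // (leq_ltn_trans _ (ltn_ord i)).
  rewrite scale1r addrC => /eqP; rewrite addr_eq0 => /eqP ->.
  rewrite -sumrN; apply: eq_bigr => j _.
  by rewrite !mxE i_last eqxx rowK scaleNr.
have i1_lt : (i.+1 < (size p).-1)%N.
  rewrite ltn_neqAle ltn_ord andbT; apply: contra i_small.
  by move=> /eqP/(congr1 predn)/= <-.
rewrite (bigD1 (Ordinal i1_lt)) //= big1 ?addr0 => [|j j_neq].
  by rewrite !mxE (negPf i_small) eqxx scale1r rowK.
rewrite !mxE (negPf i_small) -[_ == _ :> nat]/(Ordinal i1_lt == j) eq_sym.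
by rewrite (negPf j_neq) scale0r.
Qed.

(** * Prescribing the diagonal by conjugation over the base ring *)

(** Each induction step sets one diagonal entry and hands a unit entry to the smaller block; the
    trace forces the last entry. In size 1 the condition on entry (0, 1) is vacuous. *)
Lemma similar_prescribed_diagonal (R : comUnitRingType) (n : nat)
    (A : 'M[R]_n.+1) (gamma : 'I_n.+1 -> R) :
    \sum_i gamma i = \tr A ->
    (forall i j : 'I_n.+1, i = 0%N :> nat -> j = 1%N :> nat -> A i j = 1) ->
  exists (B P : 'M[R]_n.+1),
    [/\ P \in unitmx, P *m A = B *m P & forall i, B i i = gamma i].
Proof.
elim: n A gamma => [A gamma trA _|n IHn].
  exists A, 1%:M; split; first exact: unitmx1.
    by rewrite mul1mx mulmx1.
  by move=> i; rewrite (ord1 i); move: trA; rewrite /mxtrace !big_ord1.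
rewrite -[n.+2]/(1 + n.+1)%N => A gamma trA A01.
set a := A 0 0; set u := ursubmx A; set v := dlsubmx A; set D := drsubmx A.
have DA : A = block_mx a%:M u v D.
  by rewrite -[A in LHS]submxK [ulsubmx A]mx11_scalar !mxE !lshift0.
have u0 : u 0 0 = 1 by rewrite !mxE; apply: A01.
(* Conjugating by [[1, 0], [w, 1]] turns the corner a into a - u w and the
   block D into D + w u.  The entry w_1 is chosen to make entry (1, 0) of
   D + w u equal to 1, and w_0 to set the corner to gamma 0; the induction
   hypothesis then applies to the transpose of D + w u. *)
pose w1 : 'cV[R]_n.+1 := \col_k (if k == 1%N :> nat then 1 - D k 0 else 0).
pose c := (u *m w1) 0 0.
pose w : 'cV[R]_n.+1 := w1 + (a - gamma 0 - c) *: delta_mx 0 0.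
have uw : u *m w = (a - gamma 0)%:M.
  rewrite mulmxDr -scalemxAr -colE [col 0 u]mx11_scalar [col 0 u 0 0]mxE u0.
  by rewrite (mx11_scalar (u *m w1)) -/c scalemx1 -raddfD addrC subrK.
pose D1 := D + w *m u; pose gamma1 k := gamma (rshift 1 k).
(* As [w *m u] and [u *m w] have the same trace, [D1] gains the [a - gamma 0] that the corner
   loses. *)
have trD1 : \sum_k gamma1 k = \tr D1^T.
  rewrite mxtrace_tr mxtraceD mxtrace_mulC uw mxtrace_scalar.
  apply: (addrI (gamma 0)).
  move: trA; rewrite [in \tr A]DA mxtrace_block mxtrace_scalar big_split_ord.
  by rewrite big_ord1 lshift0 /= => ->; rewrite !mulr1n; ring.
have D1_10 (i j : 'I_n.+1) : i = 0%N :> nat -> j = 1%N :> nat -> D1^T i j = 1.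
  move=> i0 j1; have -> : i = 0 by apply: val_inj.
  rewrite !mxE big_ord1 u0 !mxE -[j == 0]val_eqE /= j1 /= mulr0 addr0 mulr1.
  by rewrite addrC subrK.
have [C [Q [Q_unit QD1 diagC]]] := IHn _ _ trD1 D1_10.
(* Transposing [Q *m D1^T = C *m Q] shows that [T] conjugates [D1] to [C^T]. *)
pose T := invmx Q^T.
have QT_unit : Q^T \in unitmx by rewrite unitmx_tr.
have T_unit : T \in unitmx by rewrite unitmx_inv.
have TD1 : T *m D1 = C^T *m T.
  apply: (can_inj (mulKmx QT_unit)); rewrite mulKVmx //.
  apply: (can_inj (mulmxK QT_unit)); rewrite !mulmxA mulmxKV //.
  by apply: trmx_inj; rewrite !trmx_mul !trmxK.
(* The conjugation by [[1, 0], [w, 1]] is followed by the one by diag(1, T), whose inverse is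
   diag(1, Q^T). *)
exists (block_mx (gamma 0)%:M (u *m Q^T) (T *m (v + a *: w - D1 *m w)) C^T).
exists (block_mx 1%:M 0 (T *m w) T); split.
- by rewrite unitmxE det_lblock det1 mul1r.
- rewrite {1}DA !mulmx_block !(mul1mx, mul0mx, mulmx0, addr0, add0r, mulmx1).
  have uQT : u *m Q^T *m T = u by rewrite /T mulmxK.
  rewrite [u *m Q^T *m (T *m w)]mulmxA uQT uw.
  have -> : (gamma 0)%:M + (a - gamma 0)%:M = a%:M :> 'M_1.
    by rewrite -raddfD addrC subrK.

  congr block_mx.
  + rewrite [C^T *m _]mulmxA -TD1 -!mulmxA mul_mx_scalar.
    by rewrite -[LHS]mulmxDr -[RHS]mulmxDr subrK addrC.
  + by rewrite -TD1 -mulmxA -mulmxDr addrC.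
- move=> i; case: (split_ordP i) => k ->.
    by rewrite block_mxEul ord1 mxE eqxx mulr1n lshift0.
  by rewrite block_mxEdr mxE diagC.
Qed.

(** * Integral representatives of similarity classes over the fraction field *)

(** The induction hypothesis is a premise so that the step serves twice: inside the induction with
    any nonzero [v], and at the end with a [v] that yields the unit entry. *)
Lemma integral_form_step (R : idomainType) n (A : 'M[{fraction R}]_n)
    (f : {poly R}) (v : 'rV[{fraction R}]_n) :
    integrally_closed R -> char_poly A = map_poly (@tofrac R) f -> v != 0 ->
    (forall m (D : 'M[{fraction R}]_m) (q : {poly R}),
       (m < n)%N -> char_poly D = map_poly (@tofrac R) q ->
     exists (B : 'M[R]_m) (P : 'M[{fraction R}]_m),
       P \in unitmx /\ P *m D = map_mx (@tofrac R) B *m P) ->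
  exists (B : 'M[R]_n) (P : 'M[{fraction R}]_n),
    [/\ P \in unitmx, P *m A = map_mx (@tofrac R) B *m P
      & ~~ (v *m A <= v)%MS ->
        forall i j : 'I_n, i = 0%N :> nat -> j = 1%N :> nat -> B i j = 1].
Proof.
move=> hR charA v_neq0 IH.
have [p [p_monic U_free pv0]] := krylov_minpoly A v.
have UA := krylov_companion p_monic pv0.
have size_p : (1 < size p)%N.
  rewrite ltnNge; apply: contra v_neq0 => /size1_polyC Dp.
  move/monicP: p_monic; rewrite Dp lead_coefC => p0.
  by move: pv0; rewrite Dp p0 size_poly1 big_ord1 coefC scale1r mulmx1 => ->.
(* With [p] of degree 1 the relation reads [v *m A = - p_0 v], so [v] would be an eigenvector. *)
have size_p_gt2 : ~~ (v *m A <= v)%MS -> (2 < size p)%N.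
  rewrite [(2 < _)%N]ltnNge; apply: contra => size_p_le2.
  have size_p2 : size p = 2 by apply/eqP; rewrite eqn_leq size_p_le2.
  move: pv0 (monicP p_monic); rewrite lead_coefE size_p2 /= => + p1.
  rewrite big_ord_recl big_ord1 /= p1 scale1r mulmx1 addrC => /eqP.
  by rewrite addr_eq0 => /eqP ->; rewrite -scaleNr scalemx_sub.
move: (krylov_mx A v _) U_free UA => U U_free UA.
have [m [W [X [D [Dn P0_free WA]]]]] := row_free_stable_block U_free UA.
move: (~~ _) size_p_gt2 => noneigen size_p_gt2; clear v v_neq0 pv0.
subst n; set P0 := col_mx U W in P0_free *.
have P0_unit : P0 \in unitmx by rewrite -row_free_unit.
have P0A : P0 *m A = block_mx (companionmx p) 0 X D *m P0.
  by rewrite mul_col_mx mul_block_col mul0mx addr0 UA WA.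
have Df : map_poly (@tofrac R) f = p * char_poly D.
  rewrite -charA (char_poly_similar P0_unit P0A) char_poly_lblock.
  by rewrite companionmxK.
have D_monic := char_poly_monic D.
have [p' Dp] := integrally_closed_monic_factor hR p_monic D_monic Df.
have [q Dq] : exists q : {poly R}, char_poly D = map_poly (@tofrac R) q.
  exact: (integrally_closed_monic_factor hR D_monic p_monic
    (etrans Df (mulrC _ _))).
have [|B [Q [Q_unit QD]]] := IH m D q _ Dq.
  by rewrite -[X in (X < _)%N]add0n ltn_add2r -subn1 subn_gt0.
(* Scaling [Q *m W] by [s] multiplies the off-diagonal block by [s] and leaves both diagonal blocks
   unchanged. *)
have [Y [s [s_neq0 DY]]] := mx_common_denominator (Q *m X).
(* The companion matrix of [p'], indexed by the size of [p] to fit the block of [U]. *)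
pose C := \matrix_(i < (size p).-1, j < (size p).-1)
  if i == (size p).-2 :> nat then - p'`_j else (i.+1 == j :> nat)%:R.
have mapC : map_mx (@tofrac R) C = companionmx p.
  apply/matrixP=> i j; rewrite !mxE; case: ifP => _.
    by rewrite rmorphN {2}Dp coef_map.
  by rewrite rmorph_nat.
have s_unit : tofrac s \is a GRing.unit by rewrite unitfE tofrac_eq0.
exists (block_mx C 0 Y B), (col_mx U (tofrac s *: (Q *m W))); split.
- have -> : col_mx U (tofrac s *: (Q *m W)) =
      block_mx 1%:M 0 0 (tofrac s *: Q) *m P0.
    by rewrite mul_block_col !mul0mx mul1mx addr0 add0r scalemxAl.
  rewrite unitmx_mul P0_unit andbT unitmxE det_lblock det1 mul1r -unitmxE.
  by rewrite (unitmxZ _ s_unit) Q_unit.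
- rewrite map_block_mx map_mx0 mapC -DY mul_col_mx mul_block_col mul0mx addr0 UA.
  congr col_mx; rewrite -!(scalemxAl, scalemxAr) -scalerDr; congr (_ *: _).
  by rewrite [_ *m (Q *m W)]mulmxA -QD -!mulmxA -mulmxDr WA.
- move=> /size_p_gt2 size_gt2 i j i0 j1.
  have d_gt1 : (1 < (size p).-1)%N by rewrite -ltnS prednK // ltnW.
  have -> : i = lshift m (Ordinal (ltnW d_gt1)) by apply: val_inj.
  have -> : j = lshift m (Ordinal d_gt1) by apply: val_inj.
  by rewrite block_mxEul mxE /= eq_sym gtn_eqF // -subn1 subn_gt0.
Qed.

Lemma similar_integral (R : idomainType) n (A : 'M[{fraction R}]_n)
    (f : {poly R}) :
    integrally_closed R -> char_poly A = map_poly (@tofrac R) f ->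
  exists (B : 'M[R]_n) (P : 'M[{fraction R}]_n),
    P \in unitmx /\ P *m A = map_mx (@tofrac R) B *m P.
Proof.
move=> hR; have [k] := ubnP n; elim: k n A f => // k IHk [|n] A f lt_nk charA.
  by exists 0, 1%:M; rewrite unitmx1 [LHS]thinmx0 [RHS]thinmx0.
have v_neq0 : delta_mx 0 0 != 0 :> 'rV[{fraction R}]_n.+1.
  by apply/rV0Pn; exists 0; rewrite mxE !eqxx oner_neq0.
have [|B [P [P_unit PA _]]] := integral_form_step hR charA v_neq0.
  by move=> m D q lt_mn; apply: IHk; exact: leq_trans lt_mn _.
by exists B, P.
Qed.

(** * Choice of the vector and composition of the two conjugations *)

(** If all basis vectors are eigenvectors then [A] is diagonal; if the sums of the first with each
    other one are too, the diagonal is constant. *)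
Lemma nonscalar_not_eigenvector (F : fieldType) n (A : 'M[F]_n) :
  ~~ is_scalar_mx A -> exists v : 'rV[F]_n, ~~ (v *m A <= v)%MS.
Proof.
case: n A => [|n] A; first by rewrite [A]thinmx0 mx0_is_scalar.
move=> A_nonscalar.
have [[i j] /= /andP [neq_ij Aij_neq0]|A_diag] :=
  pickP [pred ij : 'I_n.+1 * 'I_n.+1 | (ij.1 != ij.2) && (A ij.1 ij.2 != 0)].
  exists (delta_mx 0 i); apply: contra Aij_neq0 => /sub_rVP [a].
  rewrite -rowE => /rowP/(_ j); rewrite !mxE => ->.
  by rewrite [j == i]eq_sym (negPf neq_ij) andbF mulr0.
have Aij0 i j : i != j -> A i j = 0.
  by move=> neq_ij; have /= := A_diag (i, j); rewrite neq_ij => /negbFE/eqP.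
have [i /= neq_Ai|A_const] := pickP [pred i | A i i != A 0 0].
  have i_neq0 : i != 0 by apply: contraNneq neq_Ai => ->.
  exists (delta_mx 0 0 + delta_mx 0 i); apply: contra neq_Ai => /sub_rVP [a].
  rewrite mulmxDl -!rowE => /rowP DvA; move: (DvA 0) (DvA i).
  rewrite !mxE !eqxx /= (negPf i_neq0) [0 == i]eq_sym (negPf i_neq0).
  rewrite (Aij0 i 0) // (Aij0 0 i) 1?eq_sym //.
  by rewrite !(add0r, addr0, mulr1) => -> ->.
case/is_scalar_mxP: A_nonscalar; exists (A 0 0); apply/matrixP=> i j.
rewrite mxE; case: eqVneq => [<-|/Aij0 ->]; rewrite ?mulr0n // mulr1n.
by have /= /negbFE/eqP := A_const i.
Qed.

Theorem theorem2p1 (R : idomainType) (hR : integrally_closed R)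
    (n : nat) (hn : (2 <= n)%N)
    (A : 'M[R]_n) (hA : ~~ is_scalar_mx A)
    (gamma : 'I_n -> R) (hgamma : \sum_(i < n) gamma i = \tr A) :
  exists B : 'M[R]_n,
    (forall i : 'I_n, B i i = gamma i) /\
    map_mx (@tofrac R) A ~_{in unitmx} map_mx (@tofrac R) B.
Proof.
case: n hn => [|[|n]] // _ in A hA gamma hgamma *.
have charA :
    char_poly (map_mx (@tofrac R) A) = map_poly (@tofrac R) (char_poly A).
  by rewrite map_char_poly.
have [v v_noneigen] :
    exists v : 'rV[{fraction R}]_n.+2, ~~ (v *m map_mx (@tofrac R) A <= v)%MS.
  apply: nonscalar_not_eigenvector; apply: contra hA => /is_scalar_mxP [a DA].
  (* A scalar over the fraction field is the image of [A 0 0], and [tofrac] is injective. *)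
  apply/is_scalar_mxP; exists (A 0 0); apply/matrixP=> i j; apply/eqP.
  move/matrixP: DA => DA; move: (DA i j) (DA 0 0).
  by rewrite -tofrac_eq !mxE eqxx mulr1n tofracMn => -> ->.
have v_neq0 : v != 0.
  by apply: contraNneq v_noneigen => ->; rewrite mul0mx sub0mx.
have [|B [P [P_unit PA /(_ v_noneigen) B01]]] :=
  integral_form_step hR charA v_neq0.
  by move=> m D q _; exact: similar_integral.
(* The trace is preserved by similarity over the fraction field, and the equality descends to
   [R]. *)
have trB : \sum_i gamma i = \tr B.
  apply/eqP; rewrite hgamma -tofrac_eq -!trace_map_mx; apply/eqP.
  have -> : map_mx (@tofrac R) B = P *m map_mx (@tofrac R) A *m invmx P.
    by rewrite PA mulmxK.
  by rewrite mxtrace_mulC mulKmx.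
have [C [Q [Q_unit QB diagC]]] := similar_prescribed_diagonal trB B01.
have QP_unit : map_mx (@tofrac R) Q *m P \in unitmx.
  rewrite unitmx_mul P_unit andbT unitmxE det_map_mx.
  by rewrite rmorph_unit // -unitmxE.
exists C; split=> //; exists (map_mx (@tofrac R) Q *m P) => //.
by apply/(simmxP QP_unit); rewrite -mulmxA PA !mulmxA -!map_mxM QB.
Qed.
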